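(* Let $n\ge0$ and $1\le j<5$ be integers and let $p$ be a prime such that $p\nmid(n+1)$ and $p\equiv-1\pmod{2^{5-j}}$. Then for all integers $\alpha,k\ge1$ and $\beta\ge0$, $$\overline{B}_{2^{\alpha}}\left(2^{\alpha+\beta+1}p^{2^j k-1}(n+1)\right)\equiv 0 \pmod{2^{3\beta+9}}.$$
   Context: For an integer $\ell\ge 2$, $\overline{B}_\ell(n)$ denotes the number of $\ell$-regular overpartition pairs of $n$ (pairs of overpartitions with no part divisible by $\ell$ and with total sum of parts $n$; an overpartition is a partition in which the last occurrence of each part size may be overlined). Its generating function, as a formal power series in $q$, is $$\sum_{n=0}^{\infty} \overline{B}_{\ell}(n) q^n =\frac{(-q;q)^2_\infty\,(q^\ell;q^\ell)^2_\infty}{(q;q)^2_\infty\, (-q^\ell;q^\ell)^2_\infty},$$ where $(x;q)_\infty=\prod_{i=0}^\infty(1-xq^i)$. *)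

(* Defs.v *)
From mathcomp Require Import all_boot all_order all_algebra.

Set Implicit Arguments.
Unset Strict Implicit.
Unset Printing Implicit Defensive.

(* A sequence of parts, each tagged [true] when overlined. The parts are       *)
(* positive and nonincreasing; a part followed by an equal one is not the last *)
(* occurrence of its size, hence must not be overlined.                        *)
Definition is_overpartition (s : seq (nat * bool)) : bool :=
  all (fun x => 0 < x.1) s &&
  sorted (fun x y => (y.1 < x.1) || (y.1 == x.1) && ~~ x.2) s.

Definition is_regular (ell : nat) (s : seq (nat * bool)) : bool :=
  all (fun x => ~~ (ell %| x.1)) s.

Definition weight (s : seq (nat * bool)) : nat := sumn (unzip1 s).

(* An overpartition of weight at most [n] has at most [n] parts, all of them   *)
(* at most [n] (lemma [boundedP]), so it is found in this finite type.         *)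
Definition bounded (n : nat) := n.-bseq ('I_n.+1 * bool)%type.

Definition parts (n : nat) (s : bounded n) : seq (nat * bool) :=
  [seq (val x.1, x.2) | x <- s].

Lemma parts_inj (n : nat) : injective (@parts n).
Proof.
move=> s t /inj_map e; apply/val_inj/e => -[i b] [j c] [ij ->].
by rewrite (val_inj ij).
Qed.

Lemma boundedP (n : nat) (s : seq (nat * bool)) :
  is_overpartition s -> weight s <= n -> exists t : bounded n, parts t = s.
Proof.
move=> /andP[pos _] le_sn.
have le_part x : x \in s -> x.1 <= n.
  move=> xs; apply: leq_trans le_sn; rewrite /weight.
  elim: s xs {pos} => //= y s IH; rewrite inE => /predU1P[->|/IH xs].
    exact: leq_addr.
  exact: leq_trans xs (leq_addl _ _).
have le_size : size s <= n.
  apply: leq_trans le_sn; rewrite /weight.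
  by elim: s pos {le_part} => //= y s IH /andP[y0 /IH]; rewrite -add1n; apply: leq_add.
have sizeP : size [seq (inord x.1 : 'I_n.+1, x.2) | x <- s] <= n by rewrite size_map.
exists (Bseq sizeP); rewrite /parts /= -map_comp -[RHS]map_id.
by apply/eq_in_map => -[i b] /le_part /= le_in; rewrite inordK.
Qed.

Definition overpartition_pairs (ell n : nat) : {set bounded n * bounded n} :=
  [set u | [&& is_overpartition (parts u.1), is_regular ell (parts u.1),
               is_overpartition (parts u.2), is_regular ell (parts u.2)
             & weight (parts u.1) + weight (parts u.2) == n]].

Definition Bbar (ell n : nat) : nat := #|overpartition_pairs ell n|.

(* Main.v *)
Require Import Defs.
From HB Require Import structures.
From mathcomp Require Import all_boot all_order all_algebra.
From mathcomp Require Import boolp.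
From mathcomp Require Import ring zify.

(** Write [phi(q)] for the sum of [q^(k^2)] over the integers [k], and [U] for the map
    that keeps the even coefficients of a series, [sum a_n q^n -> sum a_(2n) q^n].

    By Gauss ([sgn_phi_overpart_gf]), overpartitions have the generating function
    [1 / phi(-q)], so the pairs of [L]-regular overpartitions have the generating function
    [phi(-q^L)^2 / phi(-q)^2], called [F_a] for [L = 2^a]. The count of
    representations by two squares ([evens_phi2]) gives
    [phi(q) phi(-q) = phi(-q^2)^2] and [phi(q)^2 + phi(-q)^2 = 2 phi(q^2)^2].
    For [x = phi(q) / phi(-q)] this means [F_(a+1) = x F_a(q^2)], [x(q) x(-q) = 1]
    and [x(q) + x(-q) = 2 x(q^2)^2]. The last two say that [U (x^n) = T_n (x^2)],
    with [T_n] the Chebyshev polynomial ([evens_theta_quotX]).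

    Thus [U^a F_a] is an integral polynomial in [x^2] ([evens_Bgf]). Put
    [y = x^4 - 1]. As [T_(2n) = T_n o T_2] and [T_2 (x^2) = 1 + 2 y], one more [U] leads to
    [Z + 2 y Z[y]], and as [T_2 (1 + 2 y) = 1 + 8 y (1 + y)], each further [U]
    gains a factor [8]: [U^(a+b+1) F_a] is in [Z + 2 8^b y Z[y]]
    ([evens_Bgf_mod]). Finally [y = 16 c] with [c] integral, so modulo
    [2 8^b 256 = 2^(3b+9)] and up to a constant, [U^(a+b+1) F_a] is a multiple of
    [2 8^b 16 c]. It remains to see that the coefficient of [q^N] in [c] is a
    multiple of [16] for the given [N = p^e (n + 1)], where [e + 1 = 2^j k].

    For this, use that [x] is an infinite product. Its logarithmic derivative is
    [q x' / x = 4 A], with [A] the sum of [sigma(n) q^n] over odd [n], whence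
    [q c' = A (1 + 16 c)] ([qderiv_quot_c]). For odd [N] the coefficient of [c] is therefore
    [sigma(N) / N] modulo [16], and [sigma(N)] has the factor
    [1 + p + ... + p^e], which is a multiple of
    [(1 + p) (1 + p^2) ... (1 + p^(2^(j-1)))], hence of [2^(5-j) 2^(j-1) = 16].
    For even [N] one descends by [U c = 8 c + 128 c^2] ([evens_quot_c]). *)

Set Implicit Arguments.
Unset Strict Implicit.
Unset Printing Implicit Defensive.

Import GRing.Theory Num.Theory.

(** * The ring of formal power series over the integers *)

Record fps := Fps { coef :> nat -> int }.

Lemma fpsP (a b : fps) : a =1 b -> a = b.
Proof. by case: a b => f [g] /funext /= ->. Qed.

HB.instance Definition _ := gen_eqMixin fps.
HB.instance Definition _ := gen_choiceMixin fps.

Section Fps.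
Local Open Scope ring_scope.
Implicit Types (a b c : fps) (i k m n N : nat).

Definition fps_zero := Fps (fun=> 0).
Definition fps_opp a := Fps (fun n => - a n).
Definition fps_add a b := Fps (fun n => a n + b n).

Fact fps_addA : associative fps_add.
Proof. by move=> a b c; apply: fpsP => n /=; rewrite addrA. Qed.
Fact fps_addC : commutative fps_add.
Proof. by move=> a b; apply: fpsP => n /=; rewrite addrC. Qed.
Fact fps_add0 : left_id fps_zero fps_add.
Proof. by move=> a; apply: fpsP => n /=; rewrite add0r. Qed.
Fact fps_addN : left_inverse fps_zero fps_opp fps_add.
Proof. by move=> a; apply: fpsP => n /=; rewrite addNr. Qed.

HB.instance Definition _ :=
  GRing.isZmodule.Build fps fps_addA fps_addC fps_add0 fps_addN.

Definition fps_one := Fps (fun n => (n == 0)%N%:R).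
Definition fps_mul a b := Fps (fun n => \sum_(i < n.+1) a i * b (n - i)%N).

(** The ring laws of the Cauchy product are inherited from polynomials: below
    degree [N], a series acts as its truncation. *)
Definition trunc N a : {poly int} := \poly_(i < N) a i.

Lemma coef_trunc N a i : (i < N)%N -> (trunc N a)`_i = a i.
Proof. by rewrite coef_poly => ->. Qed.

Lemma coefM_trunc N a b n :
  (n < N)%N -> fps_mul a b n = (trunc N a * trunc N b)`_n.
Proof.
move=> nN; rewrite coefM; apply: eq_bigr => -[i /= le_in] _.
by rewrite !coef_trunc //; lia.
Qed.

Lemma eq_coefMl n (p p' r : {poly int}) :
  (forall i, (i <= n)%N -> p`_i = p'`_i) -> (p * r)`_n = (p' * r)`_n.
Proof. by move=> e; rewrite !coefM; apply: eq_bigr => -[i /= ?] _; rewrite e. Qed.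

Fact fps_mulC : commutative fps_mul.
Proof.
by move=> a b; apply: fpsP => n; rewrite !(@coefM_trunc n.+1) // mulrC.
Qed.

Fact fps_mulA : associative fps_mul.
Proof.
move=> a b c; apply: fpsP => n; rewrite !(@coefM_trunc n.+1) //.
have trM a' b' i : (i <= n)%N ->
    (trunc n.+1 (fps_mul a' b'))`_i = (trunc n.+1 a' * trunc n.+1 b')`_i.
  by move=> le_in; rewrite coef_trunc ?(@coefM_trunc n.+1).
by rewrite (eq_coefMl _ (trM a b)) -mulrA mulrC (eq_coefMl _ (trM b c)) mulrC.
Qed.

Fact fps_mul1 : left_id fps_one fps_mul.
Proof.
move=> a; apply: fpsP => n /=; rewrite big_ord_recl mul1r subn0 big1 ?addr0 //.
by move=> i _; rewrite mul0r.
Qed.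

Fact fps_mulD : left_distributive fps_mul fps_add.
Proof.
move=> a b c; apply: fpsP => n /=; rewrite -big_split /=.
by apply: eq_bigr => i _; rewrite mulrDl.
Qed.

Fact fps_one_neq0 : fps_one != 0 :> fps.
Proof. by apply/eqP => /(congr1 (fun a => coef a 0)). Qed.

HB.instance Definition _ := GRing.Zmodule_isComNzRing.Build fps
  fps_mulA fps_mulC fps_mul1 fps_mulD fps_one_neq0.

Lemma fcoefD a b n : (a + b) n = a n + b n. Proof. by []. Qed.
Lemma fcoefN a n : (- a) n = - a n. Proof. by []. Qed.
Lemma fcoefB a b n : (a - b) n = a n - b n. Proof. by []. Qed.
Lemma fcoef1 n : (1 : fps) n = (n == 0)%N%:R. Proof. by []. Qed.
Lemma fcoefM a b n : (a * b) n = \sum_(i < n.+1) a i * b (n - i)%N.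
Proof. by []. Qed.
Lemma fcoefMn a k n : (a *+ k) n = a n *+ k.
Proof. by elim: k => [|k IHk]; rewrite ?mulr0n // !mulrS fcoefD IHk. Qed.
Lemma fcoef_sum I (r : seq I) P (F : I -> fps) n :
  (\sum_(i <- r | P i) F i) n = \sum_(i <- r | P i) F i n.
Proof.
by elim/big_rec2: _ => // i b c _ <-; rewrite fcoefD.
Qed.

Lemma fcoef_natM k a n : (k%:R * a) n = k%:R * a n.
Proof. by rewrite mulr_natl fcoefMn mulr_natl. Qed.

Lemma fps_natI k a b : (0 < k)%N -> k%:R * a = k%:R * b -> a = b.
Proof.
move=> k0 e; apply: fpsP => n.
move/(congr1 (fun c => coef c n)): e; rewrite !fcoef_natM.
by apply: mulfI; rewrite pnatr_eq0; lia.
Qed.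

Definition eqmodX n a b := forall i, (i <= n)%N -> a i = b i.

Lemma eqmodX_mul n a a' b b' :
  eqmodX n a a' -> eqmodX n b b' -> eqmodX n (a * b) (a' * b').
Proof.
move=> ea eb i le_in; rewrite !fcoefM; apply: eq_bigr => -[j /= lt_ji] _.
by rewrite ea ?eb //; lia.
Qed.

Definition fpsX := Fps (fun n => (n == 1)%N%:R).

Lemma fcoefXM a n : (fpsX * a) n = if n is m.+1 then a m else 0.
Proof.
rewrite fcoefM big_ord_recl mul0r add0r; case: n => [|n]; first by rewrite big_ord0.
rewrite big_ord_recl mul1r big1 ?addr0 => [|i _]; first by rewrite /bump /= subSS subn0.
by rewrite mul0r.
Qed.

Lemma fcoefXnM k a n : (fpsX ^+ k * a) n = if (k <= n)%N then a (n - k)%N else 0.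
Proof.
elim: k n => [|k IHk] n; first by rewrite mul1r subn0.
by rewrite exprS -mulrA fcoefXM; case: n => // n; rewrite IHk.
Qed.

Lemma fcoefXn k n : (fpsX ^+ k) n = (n == k)%N%:R.
Proof.
rewrite -[_ ^+ k]mulr1 fcoefXnM fcoef1; case: leqP => [le_kn|lt_nk].
  by congr (_ : bool)%:R; lia.
by have -> : (n == k) = false by lia.
Qed.

Lemma eqmodXn k n a : (n < k)%N -> eqmodX n (fpsX ^+ k * a) 0.
Proof. by move=> lt_nk i le_in; rewrite fcoefXnM ltn_geF //; lia. Qed.

Definition geom k := Fps (fun n => (k %| n)%N%:R).

Lemma geomP k : (0 < k)%N -> (1 - fpsX ^+ k) * geom k = 1.
Proof.
move=> k0; apply: fpsP => n; rewrite mulrBl mul1r fcoefB fcoefXnM fcoef1 /=.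
case: leqP => [le_kn|lt_nk].
  by rewrite dvdn_subl ?dvdnn // subrr; case: n le_kn => //; lia.
by rewrite subr0; case: n lt_nk => [|n] lt_nk; rewrite ?dvdn0 // gtnNdvd.
Qed.

(** Cancels [1 - fpsX ^+ k] from the product recurrences, which avoids division. *)
Lemma geom_regular k a b :
  (0 < k)%N -> (1 - fpsX ^+ k) * a = (1 - fpsX ^+ k) * b -> a = b.
Proof.
move=> k0 e; rewrite -[a]mul1r -[b]mul1r -(geomP k0).
by rewrite mulrAC e mulrAC.
Qed.

(** ** Substitutions and even parts *)

Definition dil m a := Fps (fun n => if (m %| n)%N then a (n %/ m)%N else 0).

Fact dil_zmod_morphism m : zmod_morphism (dil m).
Proof.
by move=> a b; apply: fpsP => n; rewrite fcoefB /=; case: ifP => // _; rewrite subr0.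
Qed.

(** Below any degree, [dil m] is the composition of polynomials with ['X^m]. The
    case [m = 0] is the evaluation at zero. *)
Fact dil_monoid_morphism m : monoid_morphism (dil m).
Proof.
case: m => [|m]; split.
- by apply: fpsP => n; rewrite /dil /fps_one /= dvd0n; case: eqP => // ->.
- move=> a b; apply: fpsP => n; rewrite fcoefM big_ord_recl /= dvd0n.
  rewrite [X in _ = _ + X]big1 => [|i _]; last by rewrite mul0r.
  by case: n => [|n]; rewrite /= ?big_ord_recl ?big_ord0 ?dvd0n ?mulr0 ?addr0.
- apply: fpsP => n /=; case: ifP => [/dvdnP[k ->]|].
    by rewrite mulnK // muln_eq0 orbF.
  by case: n.
move=> a b; apply: fpsP => n.
have coef_dil c i : (i <= n)%N -> (trunc n.+1 c \Po 'X^(m.+1))`_i = dil m.+1 c i.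
  by move=> le_in; rewrite coef_comp_poly_Xn // coef_trunc // ltnS;
     apply: leq_trans le_in; rewrite leq_div.
have tr_dil c i : (i <= n)%N ->
    (trunc n.+1 (dil m.+1 c))`_i = (trunc n.+1 c \Po 'X^(m.+1))`_i.
  by move=> le_in; rewrite coef_trunc // coef_dil.
rewrite [RHS](@coefM_trunc n.+1) // (eq_coefMl _ (tr_dil a)) [in RHS]mulrC.
rewrite (eq_coefMl _ (tr_dil b)).
rewrite [in RHS]mulrC -comp_polyM coef_comp_poly_Xn //=; case: ifP => // _.
by rewrite -coefM_trunc // ltnS leq_div.
Qed.

HB.instance Definition _ m :=
  GRing.isZmodMorphism.Build fps fps (dil m) (dil_zmod_morphism m).
HB.instance Definition _ m :=
  GRing.isMonoidMorphism.Build fps fps (dil m) (dil_monoid_morphism m).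

Lemma dil_inj m : (0 < m)%N -> injective (dil m).
Proof.
move=> m0 a b e; apply: fpsP => n.
by move/(congr1 (fun c => coef c (n * m))): e; rewrite /= dvdn_mull // mulnK.
Qed.

Lemma dil1 a : dil 1 a = a.
Proof. by apply: fpsP => n /=; rewrite dvd1n divn1. Qed.

Lemma dil_dil m k a : (0 < m)%N -> (0 < k)%N -> dil m (dil k a) = dil (m * k) a.
Proof.
move=> m0 k0; apply: fpsP => n /=.
have [/dvdnP[d ->]|mn] := boolP (m %| n)%N.
  by rewrite mulnK // (mulnC d) dvdn_pmul2l // divnMl.
by case: ifP mn => // /(dvdn_trans (dvdn_mulr _ (dvdnn m))) ->.
Qed.

Lemma dil_Xn m k : (0 < m)%N -> dil m (fpsX ^+ k) = fpsX ^+ (m * k).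
Proof.
move=> m0; apply: fpsP => n /=; rewrite !fcoefXn.
have [/dvdnP[d ->]|mn] := boolP (m %| n)%N.
  by rewrite mulnK // (mulnC d) eqn_pmul2l.
by case: eqP mn => // ->; rewrite dvdn_mulr.
Qed.

Definition sgn a := Fps (fun n => (-1) ^+ n * a n).

Fact sgn_zmod_morphism : zmod_morphism sgn.
Proof. by move=> a b; apply: fpsP => n; rewrite !fcoefB /= mulrBr. Qed.

Fact sgn_monoid_morphism : monoid_morphism sgn.
Proof.
split; first by apply: fpsP => -[|n] //=; rewrite mulr0.
move=> a b; apply: fpsP => n; rewrite fcoefM /= big_distrr /=.
apply: eq_bigr => -[i /= le_in] _; rewrite mulrACA -exprD.
by have -> : (i + (n - i) = n)%N by lia.
Qed.

HB.instance Definition _ := GRing.isZmodMorphism.Build fps fps sgn sgn_zmod_morphism.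
HB.instance Definition _ :=
  GRing.isMonoidMorphism.Build fps fps sgn sgn_monoid_morphism.

Lemma sgnK : involutive sgn.
Proof. by move=> a; apply: fpsP => n /=; rewrite signrMK. Qed.

Definition evens a := Fps (fun n => a n.*2).

Fact evens_zmod_morphism : zmod_morphism evens.
Proof. by move=> a b; apply: fpsP. Qed.
HB.instance Definition _ :=
  GRing.isZmodMorphism.Build fps fps evens evens_zmod_morphism.

Lemma add_sgn a : a + sgn a = 2%:R * dil 2 (evens a).
Proof.
apply: fpsP => n; rewrite fcoef_natM fcoefD /= dvdn2 divn2 -signr_odd.
have := odd_double_half n; case: odd => /= [_|].
  by rewrite expr1 mulN1r subrr mulr0.
by rewrite add0n => ->; rewrite expr0 mul1r mulr_natl mulr2n.
Qed.

(** Since [2] is not a zero divisor, the even part of a series is read off from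
    its sum with the twist [sgn]; the identities below all use this form. *)
Lemma evensE a b : a + sgn a = 2%:R * dil 2 b -> evens a = b.
Proof. by rewrite add_sgn => /(@fps_natI 2 _ _ isT) /(@dil_inj 2 isT). Qed.

Lemma sgn_dil a : sgn (dil 2 a) = dil 2 a.
Proof.
apply: fpsP => n /=; rewrite dvdn2; case: ifP => [/negPf on|_]; last by rewrite mulr0.
by rewrite -signr_odd on mul1r.
Qed.

(** Series in [q ^ 2] are scalars for the extraction of even coefficients. *)
Lemma evens_dilM a b : evens (dil 2 a * b) = a * evens b.
Proof.
by apply: evensE; rewrite rmorphM /= sgn_dil -mulrDr add_sgn rmorphM /=; ring.
Qed.

(** The derivation [q d/dq]. *)
Definition qderiv a := Fps (fun n => n%:R * a n).

Lemma qderivD a b : qderiv (a + b) = qderiv a + qderiv b.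
Proof. by apply: fpsP => n; rewrite fcoefD /= -mulrDr. Qed.

Lemma qderivB a b : qderiv (a - b) = qderiv a - qderiv b.
Proof. by apply: fpsP => n; rewrite fcoefB /= -mulrBr. Qed.

Lemma qderiv_natM k a : qderiv (k%:R * a) = k%:R * qderiv a.
Proof.
by apply: fpsP => n; rewrite fcoef_natM -[LHS]/(n%:R * (k%:R * a) n) fcoef_natM mulrCA.
Qed.

Lemma qderivM a b : qderiv (a * b) = qderiv a * b + a * qderiv b.
Proof.
apply: fpsP => n; rewrite fcoefD !fcoefM /= big_distrr -big_split /=.
apply: eq_bigr => -[i /= le_in] _.
have -> : n%:R = i%:R + (n - i)%N%:R :> int by rewrite -natrD; congr _%:R; lia.
ring.
Qed.

Lemma qderiv1 : qderiv 1 = 0.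
Proof. by apply: fpsP => -[|n] //=; rewrite mulr0. Qed.

Lemma qderivXn k : qderiv (fpsX ^+ k) = k%:R * fpsX ^+ k.
Proof.
apply: fpsP => n; rewrite fcoef_natM -[LHS]/(n%:R * (fpsX ^+ k) n) fcoefXn.
by case: eqP => [->|_] //; rewrite !mulr0.
Qed.

Lemma qderiv_sgn a : qderiv (sgn a) = sgn (qderiv a).
Proof. by apply: fpsP => n /=; rewrite mulrCA. Qed.

End Fps.

(** * Gauss's alternating sum over squares, in finite form *)

Section GaussSum.
Local Open Scope ring_scope.
Variables (R : comNzRingType) (q : R) (h : nat -> R).
Hypothesis hP : forall i, (0 < i)%N -> (1 + q ^+ i) * h i = 1.

(** Here [h i] stands for [1 / (1 + q ^+ i)], and [t n s] is a finite expansion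
    whose term [s = 0] is the product of the [(1 - q ^+ i) / (1 + q ^+ i)] for
    [i <= n], every other term being a multiple of [q ^+ n.+1]. *)
Let r i := (1 - q ^+ i) * h i.
Let e s := if s is 0 then 1 else 2%:R * h s.
Let t n s := (-1) ^+ s * e s * q ^+ (s * n.+1) * \prod_(s <= i < n) r i.+1.

(** With [w s] the bracket on the right for [m = s], the summand of index [s] is
    [2 h_(n+1) (-1)^(s+1) (w (s - 1) + w s)], so the alternating sum collapses. *)
Lemma gauss_telescope n m : (m <= n)%N ->
  \sum_(s < m.+1) (t n.+1 s - t n s) =
  2%:R * h n.+1 * (-1) ^+ m.+1 *
    (q ^+ (m.+1 * n.+1) * \prod_(m <= i < n) r i.+1).
Proof.
elim: m => [|m IHm] le_mn.
  rewrite big_ord1 /t big_nat_recr //= !mul0n /r !expr0 mul1n.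
  have Hh := @hP n.+1 isT; set P := bigop _ _ _.
  set B := q ^+ n.+1 in Hh *; set k := h n.+1 in Hh *.
  transitivity (P * ((1 - B) * k) - P * ((1 + B) * k)); first by rewrite Hh; ring.
  ring.
rewrite big_ord_recr /= IHm 1?ltnW // /t (big_ltn le_mn) big_nat_recr //=.
set P := \prod_(_ <= _ < _) _.
have Hg := @hP m.+1 isT; have Hh := @hP n.+1 isT; rewrite /r.
set g := h m.+1 in Hg *; set k := h n.+1 in Hh *.
rewrite [(m.+1 * n.+2)%N]mulnS [(m.+2 * n.+1)%N]mulSn !exprD.
set A := q ^+ m.+1 in Hg *; set B := q ^+ n.+1 in Hh *.
set C := q ^+ (m.+1 * n.+1); rewrite [in RHS]exprS; set s := (-1) ^+ m.+1.
transitivity (2%:R * s * C * P * (k * (1 - A) * g + A * g * ((1 - B) * k)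
   - g * ((1 + B) * k))); first by rewrite Hh; ring.
transitivity (- 2%:R * s * C * P * k * (B * ((1 + A) * g))).
  ring.
by rewrite Hg; ring.
Qed.

(** Going from [n] to [n.+1] adds the collapsed sum and the new term [s = n.+1],
    that is [2 h_(n+1) (-1)^(n+1) q^((n+1)^2) (1 + q^(n+1))], which is a square
    monomial because [h_(n+1)] cancels the last factor. *)
Lemma gauss_finite n :
  \sum_(s < n.+1) t n s =
  1 + 2%:R * \sum_(k < n) (-1) ^+ k.+1 * q ^+ (k.+1 ^ 2).
Proof.
elim: n => [|n IHn].
  by rewrite big_ord1 big_ord0 /t big_geq //= mul0n !mulr1 mulr0 addr0.
have tot := gauss_telescope (leqnn n).
rewrite sumrB IHn in tot.
rewrite big_ord_recr /= (canRL (subrK _) tot) [in RHS]big_ord_recr /=.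
rewrite /t !big_geq //= !mulr1.
have Hh := @hP n.+1 isT; set h' := h n.+1 in Hh *.
rewrite [(n.+1 * n.+2)%N]mulnS -mulnn exprD; set B := q ^+ n.+1 in Hh *.
set C := q ^+ _; set s := (-1) ^+ n.+1; set S := bigop _ _ _.
transitivity (1 + 2%:R * (S + s * C * ((1 + B) * h'))); first by ring.
by rewrite Hh mulr1.
Qed.

End GaussSum.

(** * The qderiv series of the squares *)

Section Theta.
Local Open Scope ring_scope.

Definition zbox B : seq int :=
  0 :: [seq Posz k | k <- iota 1 B] ++ [seq - Posz k | k <- iota 1 B].

Lemma mem_zbox B (k : int) : (k \in zbox B) = (`|k| <= B)%N.
Proof.
rewrite inE mem_cat; apply/or3P/idP => [[/eqP->//|/mapP[i]|/mapP[i]]|le_kB].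
- by rewrite mem_iota => ? ->; lia.
- by rewrite mem_iota => ? ->; lia.
case: (intP k) le_kB => [|i|i] le_kB; first by constructor 1.
  by constructor 2; apply/mapP; exists i.+1 => //; rewrite mem_iota; lia.
by constructor 3; apply/mapP; exists i.+1 => //; rewrite mem_iota; lia.
Qed.

Lemma zbox_uniq B : uniq (zbox B).
Proof.
rewrite /= mem_cat cat_uniq !map_inj_uniq ?iota_uniq /=; first last.
- by move=> i j [].
- by move=> i j; lia.
rewrite andbT negb_or; apply/andP; split; first apply/andP; try split.
- by apply/mapP => -[i]; rewrite mem_iota; lia.
- by apply/mapP => -[i]; rewrite mem_iota; lia.
apply/hasPn => _ /mapP[i + ->]; rewrite mem_iota => i0.
by apply/mapP => -[j]; rewrite mem_iota; lia.
Qed.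

Lemma sum_zbox (B : nat) (F : int -> int) : (forall k, F (- k) = F k) ->
  \sum_(k <- zbox B) F k = F 0 + 2%:R * \sum_(k < B) F k.+1%:Z.
Proof.
move=> evenF; rewrite big_cons big_cat !big_map /=; congr (_ + _).
under [X in _ + X]eq_bigr do rewrite evenF.
rewrite mulr_natl mulr2n; have -> // : \sum_(i <- iota 1 B) F i = \sum_(k < B) F k.+1%:Z.
by rewrite -(big_mkord xpredT (fun k => F k.+1%:Z)) /index_iota subn0
  -[1%N]/(1 + 0)%N iotaDl big_map.
Qed.

(** Ramanujan's qderiv series: the sum of [q ^ (k ^ 2)] over all integers [k]. *)
Definition phi := Fps (fun n => \sum_(k <- zbox n) (`|k| ^ 2 == n)%N%:R).

Arguments zbox : simpl never.

Lemma coef_phi B n : (n <= B)%N ->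
  phi n = (n == 0)%N%:R + 2%:R * \sum_(k < B) (n == k.+1 ^ 2)%N%:R.
Proof.
move=> le_nB; rewrite [LHS]sum_zbox => [|k]; last by rewrite abszN.
congr (_ + 2 * _); first by rewrite eq_sym.
pose F k : int := (k.+1 ^ 2 == n)%N%:R.
under [RHS]eq_bigr => k _ do rewrite eq_sym.
rewrite -[LHS]/(\sum_(k < n) F k) -[RHS]/(\sum_(k < B) F k).
rewrite -!(big_mkord xpredT F) [RHS](@big_cat_nat _ _ _ n) //=.
rewrite [X in _ = _ + X]big1_seq ?addr0 // => k /andP[_]; rewrite /F.
by rewrite mem_index_iota => ?; have -> : (k.+1 ^ 2 == n)%N = false by nia.
Qed.

Lemma phi_square n : phi n != 0 -> exists k, n = (k ^ 2)%N.
Proof.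
rewrite (coef_phi (leqnn n)).
have [->|n0] := eqVneq n 0%N; first by exists 0%N.
rewrite add0r; case: (pickP (fun k : 'I_n => n == k.+1 ^ 2)%N) => [k /eqP nk _|none].
  by exists k.+1.
by rewrite big1 ?mulr0 ?eqxx // => k _; rewrite none.
Qed.

Lemma phi_zbox B n : (n <= B)%N -> phi n = \sum_(k <- zbox B) (`|k| ^ 2 == n)%N%:R.
Proof.
move=> le_nB; rewrite (coef_phi le_nB) sum_zbox => [|k]; last by rewrite abszN.
by congr (_ + 2 * _); [rewrite eq_sym | apply: eq_bigr => k _; rewrite eq_sym].
Qed.

Definition two_squares n : seq (int * int) :=
  [seq z <- [seq (k, l) | k <- zbox n, l <- zbox n] | `|z.1| ^ 2 + `|z.2| ^ 2 == n]%N.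

Lemma mem_two_squares n z : (z \in two_squares n) = (`|z.1| ^ 2 + `|z.2| ^ 2 == n)%N.
Proof.
rewrite mem_filter andb_idr // => /eqP nz; apply/allpairsP; exists z; rewrite !mem_zbox.
have sq_ge m : (m <= m ^ 2)%N by case: m => // m; rewrite -mulnn leq_pmulr.
split; last by case: (z).
- by apply: leq_trans (sq_ge _) _; rewrite -nz leq_addr.
- by apply: leq_trans (sq_ge _) _; rewrite -nz leq_addl.
Qed.

Lemma two_squares_uniq n : uniq (two_squares n).
Proof.
apply/filter_uniq/allpairs_uniq; [exact: zbox_uniq | exact: zbox_uniq |].
by move=> [a b] [c d] _ _ [-> ->].
Qed.

Lemma coef_phi2 n : (phi * phi) n = (size (two_squares n))%:R.
Proof.
rewrite fcoefM -sum1_size big_filter natr_sum.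
rewrite [RHS]big_mkcond big_allpairs.
transitivity (\sum_(i < n.+1) \sum_(k <- zbox n)
  (`|k| ^ 2 == i)%N%:R * \sum_(l <- zbox n) (`|l| ^ 2 == n - i)%N%:R : int).
  apply: eq_bigr => i _; rewrite -big_distrl /=.
  by rewrite -!phi_zbox ?leq_subr // -ltnS.
rewrite exchange_big; apply: eq_bigr => k _ /=.
under eq_bigr => i _ do rewrite big_distrr /=.
rewrite exchange_big; apply: eq_bigr => l _ /=.
have [le_kn|lt_nk] := leqP (`|k| ^ 2)%N n; last first.
  rewrite big1 => [|i _]; first by have -> : (`|k| ^ 2 + `|l| ^ 2 == n)%N = false by lia.
  have -> : (`|k| ^ 2 == i)%N = false by have := ltn_ord i; lia.
  by rewrite mul0r.
rewrite (bigD1 (Ordinal (le_kn : `|k| ^ 2 < n.+1)%N)) //= eqxx mul1r big1 => [|i]; last first.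
  by rewrite -val_eqE /= eq_sym => /negPf ->; rewrite mul0r.
have -> : (`|l| ^ 2 == n - `|k| ^ 2)%N = (`|k| ^ 2 + `|l| ^ 2 == n)%N by lia.
by rewrite addr0; case: eqP.
Qed.

(** [n] and [2 n] have equally many representations as a sum of two squares: the
    substitution [(u, v) -> (u + v, u - v)] doubles [u ^ 2 + v ^ 2], and it is onto
    because [x ^ 2 + y ^ 2] even forces [x] and [y] to have the same parity. *)
Lemma evens_phi2 : evens (phi * phi) = phi * phi.
Proof.
apply: fpsP => n; rewrite [LHS]coef_phi2 coef_phi2; congr _%:R.
pose g (z : int * int) := (z.1 + z.2, z.1 - z.2).
have g_inj : injective g.
  by move=> [a b] [c d] [e1 e2]; congr (_, _); lia.
rewrite -(size_map g (two_squares n)); apply/perm_size/uniq_perm.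
- exact: two_squares_uniq.
- by rewrite map_inj_uniq ?two_squares_uniq.
have sqz (k : int) : (`|k| ^ 2)%N%:Z = k * k.
  by rewrite -mulnn PoszM abszE -normrM ger0_norm // -expr2 sqr_ge0.
move=> [x y]; rewrite mem_two_squares /=; apply/idP/mapP => [/eqP xy|[[u v]]].
  have xyz : x * x + y * y = 2 * n%:Z by rewrite -!sqz; lia.
  have [u xE] : exists u, x = 2 * u - y.
    exists ((x + y) %/ 2)%Z.
    have : x + y = 2 * ((x + y) %/ 2)%Z + ((x + y) %% 2)%Z by lia.
    by nia.
  exists (u, u - y); last by rewrite /g /=; congr (_, _); lia.
  rewrite mem_two_squares /=; apply/eqP.
  suff : (`|u|^2 + `|(u - y)%R|^2)%N%:Z = n%:Z by lia.
  by rewrite PoszD !sqz; nia.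
rewrite mem_two_squares /= => /eqP uv [-> ->]; apply/eqP.
have uvz : u * u + v * v = n%:Z by rewrite -!sqz; lia.
suff : (`|(u + v)%R| ^ 2 + `|(u - v)%R| ^ 2)%N%:Z = n.*2%:Z by lia.
by rewrite PoszD !sqz; nia.
Qed.

(** If [k ^ 2 + l ^ 2 = 2 n], then [l] has the parity of [n], so that all the
    representations of [2 n] are counted with the same sign. *)
Lemma evens_phi_sgn : evens (phi * sgn phi) = sgn (phi * phi).
Proof.
apply: fpsP => n; rewrite -[LHS]/((phi * sgn phi) n.*2).
rewrite -[RHS]/((-1) ^+ n * (phi * phi) n) -[in RHS]evens_phi2.
rewrite -[in RHS]/((phi * phi) n.*2) !fcoefM mulr_sumr.
apply: eq_bigr => i _; have lt_in := ltn_ord i.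
rewrite -[sgn phi _]/((-1) ^+ (n.*2 - i) * phi (n.*2 - i)%N).
have [->|/phi_square[k ik]] := eqVneq (phi i) 0; first by rewrite !mul0r mulr0.
have [->|/phi_square[l jl]] := eqVneq (phi (n.*2 - i)%N) 0.
  by rewrite !mulr0.
rewrite mulrCA; congr (_ * _).
rewrite -signr_odd -[in RHS]signr_odd; congr (_ ^+ nat_of_bool _).
rewrite jl oddX /=.
have kl : (k ^ 2 + l ^ 2 = n.*2)%N by lia.
have := odd_double_half k; have := odd_double_half l.
have := congr1 odd kl; rewrite oddD !oddX odd_double /=.
case: (odd k); case: (odd l) => //= _; nia.
Qed.

Lemma sgn_phi_mul : phi * sgn phi = dil 2 (sgn phi) ^+ 2.
Proof.
apply: (@fps_natI 2) => //; rewrite -rmorphXn /=.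
have -> : sgn phi ^+ 2 = evens (phi * sgn phi) by rewrite evens_phi_sgn rmorphM.
by rewrite -add_sgn rmorphM /= sgnK; ring.
Qed.

Lemma phi2_add : phi ^+ 2 + sgn phi ^+ 2 = 2%:R * dil 2 phi ^+ 2.
Proof. by rewrite -!rmorphXn /= add_sgn expr2 evens_phi2. Qed.

End Theta.

(** * Counting regular overpartitions *)

Section Overpartitions.
Implicit Types (ell M n k : nat) (x y : nat * bool) (s : seq (nat * bool)).

Lemma is_overpartition_cons x s :
  is_overpartition (x :: s) =
  [&& 0 < x.1, is_overpartition s
    & if s is y :: _ then (y.1 < x.1) || (y.1 == x.1) && ~~ x.2 else true].
Proof.
rewrite /is_overpartition /=; case: s => [|y s] /=; first by rewrite !andbT.
by rewrite -!andbA; do !bool_congr.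
Qed.

Lemma overpartition_le x s :
  is_overpartition (x :: s) -> all (fun y => y.1 <= x.1) s.
Proof.
case/andP => _ /= sorted_xs; apply: (@order_path_min _ (fun x y : nat * bool => y.1 <= x.1)).
  by move=> y z t /= yz ty; apply: leq_trans ty yz.
by apply: sub_path sorted_xs => y z /orP[/ltnW|/andP[/eqP->]].
Qed.

Definition reg_parts ell M s :=
  [&& is_overpartition s, is_regular ell s & all (fun x => x.1 <= M) s].

Lemma reg_parts_dvd ell M s : ell %| M.+1 -> reg_parts ell M.+1 s = reg_parts ell M s.
Proof.
move=> dvdM; rewrite /reg_parts; case: is_overpartition => //=.
rewrite /is_regular -!all_predI; apply: eq_all => x /=.
by rewrite [x.1 <= M.+1]leq_eqVlt; case: eqP => [->|]; rewrite ?dvdM.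
Qed.

(** The largest part comes first, so only the head can reach the bound. *)
Lemma reg_parts_cons ell M k b s : ~~ (ell %| M.+1) ->
  reg_parts ell M.+1 ((k, b) :: s) =
  if k == M.+1 then reg_parts ell (if b then M else M.+1) s
  else reg_parts ell M ((k, b) :: s).
Proof.
move=> ndvdM; rewrite /reg_parts.
have [->|k_neq] := eqVneq k M.+1; last first.
  have [ops|] //= := boolP (is_overpartition _).
  have /allP le_k := overpartition_le ops.
  congr (_ && _); rewrite [k <= M.+1]leq_eqVlt (negPf k_neq) /= ltnS.
  case: leqP => //= le_kM; apply/eq_in_all => y /le_k /= le_yk.
  by rewrite !(leq_trans le_yk) // ltnW.
rewrite is_overpartition_cons /= leqnn ndvdM /=.
have [ops|] //= := boolP (is_overpartition s).
case: (is_regular ell s); rewrite /= ?andbF //.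
case: s ops => [|y s] ops; first by case: (b).
have /allP le_y := overpartition_le ops.
case: b => /=; rewrite ?andbF ?orbF ?andbT.
  rewrite !ltnS; case: (leqP y.1 M) => //= le_yM.
  rewrite leqW //=; apply/eq_in_all => z /le_y le_zy.
  by rewrite !(leq_trans le_zy) // ltnW.
by rewrite orbC -leq_eqVlt; case: (y.1 <= M.+1).
Qed.

(** Lets any duplicate-free list replace the finite type of bounded sequences, so
    that counting arguments need not track the bound on the length. *)
Lemma card_bounded n (P : pred (seq (nat * bool))) e :
  uniq e -> (forall s, (s \in e) = P s) ->
  (forall s, P s -> is_overpartition s && (weight s <= n)) ->
  #|[set t : bounded n | P (parts t)]| = size e.
Proof.
move=> uniq_e eP Pn; rewrite cardE -(size_map (@parts n)).
apply/perm_size/uniq_perm => //.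
  by rewrite map_inj_uniq ?enum_uniq //; apply: parts_inj.
move=> s; rewrite eP; apply/mapP/idP => [[t + ->]|Ps].
  by rewrite mem_enum inE.
have /andP[ops le_sn] := Pn s Ps; have [t ts] := boundedP ops le_sn.
by exists t; rewrite // mem_enum inE ts.
Qed.

Definition nb_overparts ell M n :=
  #|[set t : bounded n | reg_parts ell M (parts t) && (weight (parts t) == n)]|.

Lemma nb_overparts_size ell M n e :
  uniq e -> (forall s, (s \in e) = reg_parts ell M s && (weight s == n)) ->
  nb_overparts ell M n = size e.
Proof.
move=> uniq_e eP.
apply: (@card_bounded n (fun s => reg_parts ell M s && (weight s == n))) => // s.
by case/andP => /and3P[-> _ _] /eqP->; rewrite leqnn.
Qed.

Lemma nb_overparts_enum ell M n : exists e,
  uniq e /\ (forall s, (s \in e) = reg_parts ell M s && (weight s == n)).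
Proof.
pose A := [set t : bounded n | reg_parts ell M (parts t) && (weight (parts t) == n)].
exists [seq parts t | t <- enum A]; split.
  by rewrite map_inj_uniq ?enum_uniq //; apply: parts_inj.
move=> s; apply/mapP/idP => [[t + ->]|Ps]; first by rewrite mem_enum inE.
have /andP[/and3P[ops _ _] /eqP wn] := Ps.
have [t ts] := boundedP ops (eq_leq wn).
by exists t; rewrite // mem_enum inE ts.
Qed.

Lemma nb_overparts0 ell n : nb_overparts ell 0 n = (n == 0).
Proof.
have -> : nat_of_bool (n == 0) = size (nseq (n == 0) [::] : seq (seq (nat * bool))).
  by rewrite size_nseq.
apply: nb_overparts_size => [|s]; first by case: eqP.
rewrite mem_nseq; case: s => [|[k b] s] /=; first by rewrite eqxx andbT; case: n.
rewrite andbF /reg_parts is_overpartition_cons /=.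
by case: k => //= k; rewrite !andbF.
Qed.

(** Classify by the head: either no part equals [M.+1], or removing a first part
    [M.+1] leaves parts at most [M.+1] if it is not overlined, and at most [M] if
    it is, since an overlined part is the last of its size. *)
Lemma nb_overparts_rec ell M n : ~~ (ell %| M.+1) ->
  nb_overparts ell M.+1 n = nb_overparts ell M n +
    if M.+1 <= n then nb_overparts ell M.+1 (n - M.+1) + nb_overparts ell M (n - M.+1) else 0.
Proof.
move=> ndvdM.
have [e1 [u1 m1]] := nb_overparts_enum ell M n.
have [e2 [u2 m2]] := nb_overparts_enum ell M.+1 (n - M.+1).
have [e3 [u3 m3]] := nb_overparts_enum ell M (n - M.+1).
pose e := e1 ++ if M.+1 <= n then [seq (M.+1, false) :: s | s <- e2]
                                 ++ [seq (M.+1, true) :: s | s <- e3] else [::].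
have cons_inj (x : nat * bool) : injective (cons x) by move=> s t [].
have no_max b s : ((M.+1, b) :: s) \notin e1.
  by rewrite m1 /reg_parts /= ltnn !andbF.
rewrite (nb_overparts_size u1 m1) (nb_overparts_size u2 m2) (nb_overparts_size u3 m3).
rewrite (@nb_overparts_size _ _ _ e).
- by rewrite size_cat; case: ifP => _ //=; rewrite size_cat !size_map.
- rewrite cat_uniq u1 /=; case: ifP => //= _.
  rewrite cat_uniq !map_inj_uniq // u2 u3 /= andbT; apply/andP; split.
    apply/hasPn => s; rewrite mem_cat.
    by case/orP=> /mapP[t _ ->]; apply: no_max.
  by apply/hasPn => _ /mapP[t _ ->]; apply/mapP => -[t' _ []].
move=> s; rewrite mem_cat m1.
case: s => [|[k b] s].
  rewrite orbC; case: ifP => _ //; rewrite mem_cat.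
  by case: mapP => [[? _ //]|_]; case: mapP => [[? _ //]|_].
rewrite reg_parts_cons // /weight /= -/(weight s).
have mem_cons b' (t : seq (seq (nat * bool))) :
    ((k, b) :: s \in [seq (M.+1, b') :: s | s <- t]) = [&& k == M.+1, b == b' & s \in t].
  apply/mapP/and3P => [[s' s't [-> -> ->]]|[/eqP-> /eqP-> st]]; first by rewrite !eqxx.
  by exists s.
have [kM|k_neq] := eqVneq k M.+1; last first.
  by case: ifP => _; rewrite ?mem_cat ?mem_cons ?(negPf k_neq) ?orbF.
rewrite {1}kM {1}/reg_parts /= {1}ltnn !andbF /=.
have [le_Mn|lt_nM] := leqP M.+1 n; last first.
  by rewrite in_nil; symmetry; apply/negbTE; rewrite negb_and orbC; apply/orP; left; lia.
rewrite mem_cat !mem_cons kM eqxx m2 m3 /=.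
have -> : (M.+1 + weight s == n) = (weight s == n - M.+1) by lia.
by case: b {mem_cons}; rewrite /= ?orbF.
Qed.

End Overpartitions.

Section Pairs.
Implicit Types (ell M n k : nat) (s : seq (nat * bool)).

Lemma nb_overparts_stable ell M n : n <= M -> nb_overparts ell M n = nb_overparts ell n n.
Proof.
move=> /subnKC <-; elim: (M - n) => [|d IHd]; first by rewrite addn0.
rewrite addnS -IHd; have [dvd|ndvd] := boolP (ell %| (n + d).+1).
  have [e [ue me]] := nb_overparts_enum ell (n + d) n.
  rewrite (nb_overparts_size ue me); apply: nb_overparts_size => // s.
  by rewrite me reg_parts_dvd.
by rewrite nb_overparts_rec // ltnNge leq_addr addn0.
Qed.

Lemma parts_le_weight s : all (fun x => x.1 <= weight s) s.
Proof.
elim: s => //= x s IHs; rewrite /weight /= leq_addr.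
by apply: sub_all IHs => y; rewrite /weight => le_y; apply: leq_trans le_y (leq_addl _ _).
Qed.

Lemma Bbar_conv ell n : Bbar ell n =
  \sum_(i < n.+1) nb_overparts ell i i * nb_overparts ell (n - i) (n - i).
Proof.
pose A i := [set t : bounded n | reg_parts ell n (parts t) && (weight (parts t) == i)].
have card_A i : i <= n -> #|A i| = nb_overparts ell i i.
  move=> le_in; rewrite -(nb_overparts_stable _ le_in).
  have [e [ue me]] := nb_overparts_enum ell n i; rewrite (nb_overparts_size ue me).
  apply: (@card_bounded n (fun s => reg_parts ell n s && (weight s == i)) e) => // s.
  by case/andP => /and3P[-> _ _] /eqP->; rewrite le_in.
rewrite /Bbar -sum1_card.
rewrite (partition_big (fun u : bounded n * bounded n => inord (weight (parts u.1)) : 'I_n.+1)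
  xpredT) //=.
apply: eq_bigr => i _; have le_in : i <= n by rewrite -ltnS.
rewrite -!card_A ?leq_subr // -cardsX -sum1_card; apply: eq_bigl => -[t u].
rewrite !inE /= /reg_parts.
apply/andP/andP => [[/and5P[t1 t2 u1 u2 /eqP w] /eqP wi]|].
  have wt : weight (parts t) = i.
    by rewrite -wi inordK // ltnS (leq_trans (leq_addr _ _) (eq_leq w)).
  have wu : weight (parts u) = n - i by move/(canRL (addKn _)): w; rewrite wt.
  have le_n s : weight s <= n -> all (fun x => x.1 <= n) s.
    by move=> le_sn; apply: sub_all (parts_le_weight s) => x le_x; apply: leq_trans le_x le_sn.
  by rewrite t1 t2 u1 u2 wt wu !eqxx !le_n ?wt ?wu ?leq_subr.
case=> /andP[/and3P[-> -> _] /eqP wt] /andP[/and3P[-> -> _] /eqP wu].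
by rewrite wt wu subnKC // eqxx inord_val.
Qed.

End Pairs.

(** * Generating functions of overpartitions *)

Section GeneratingFunctions.
Local Open Scope ring_scope.
Implicit Types (ell M n k : nat).

Definition overpart_gf_upto ell M := Fps (fun n => (nb_overparts ell M n)%:R).
Definition overpart_gf ell := Fps (fun n => (nb_overparts ell n n)%:R).

Lemma overpart_gf_uptoE ell M : eqmodX M (overpart_gf_upto ell M) (overpart_gf ell).
Proof. by move=> n le_nM /=; rewrite nb_overparts_stable. Qed.

Lemma coef_Bbar ell n : (Bbar ell n)%:R = (overpart_gf ell ^+ 2) n.
Proof.
by rewrite Bbar_conv natr_sum expr2; apply: eq_bigr => i _; rewrite natrM.
Qed.

Lemma overpart_gf_upto0 ell : overpart_gf_upto ell 0 = 1.
Proof. by apply: fpsP => n /=; rewrite nb_overparts0. Qed.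

Lemma overpart_gf_upto_dvd ell M : (ell %| M.+1)%N ->
  overpart_gf_upto ell M.+1 = overpart_gf_upto ell M.
Proof.
move=> dvdM; apply: fpsP => n /=; have [e [ue me]] := nb_overparts_enum ell M n.
rewrite (nb_overparts_size ue me); congr _%:R; apply: nb_overparts_size => // s.
by rewrite me reg_parts_dvd.
Qed.

(** The recurrence on the largest part: the factor of the size [M.+1] in the product
    is [(1 + q ^ M.+1) / (1 - q ^ M.+1)]. *)
Lemma overpart_gf_uptoS ell M : ~~ (ell %| M.+1)%N ->
  (1 - fpsX ^+ M.+1) * overpart_gf_upto ell M.+1 = (1 + fpsX ^+ M.+1) * overpart_gf_upto ell M.
Proof.
move=> ndvd; apply: fpsP => n; rewrite mulrBl mulrDl !mul1r fcoefB fcoefD !fcoefXnM.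
rewrite -[overpart_gf_upto ell M.+1 n]/((nb_overparts ell M.+1 n)%:R) nb_overparts_rec //.
case: (leqP M.+1 n) => _; last by rewrite addn0 subr0.
by rewrite !natrD /=; ring.
Qed.

Lemma overpart_gf_upto0S M :
  (1 - fpsX ^+ M.+1) * overpart_gf_upto 0 M.+1 = (1 + fpsX ^+ M.+1) * overpart_gf_upto 0 M.
Proof. by rewrite overpart_gf_uptoS. Qed.

Lemma overpart_gf_upto_dil ell M : (0 < ell)%N ->
  overpart_gf_upto 0 M = overpart_gf_upto ell M * dil ell (overpart_gf_upto 0 (M %/ ell)).
Proof.
move=> ell0; elim: M => [|M IHM]; first by rewrite div0n !overpart_gf_upto0 rmorph1 mulr1.
apply: (@geom_regular M.+1) => //; rewrite overpart_gf_upto0S IHM divnS //.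
have [dvdM|ndvdM] := boolP (ell %| M.+1)%N; last first.
  by rewrite add0n !mulrA overpart_gf_uptoS.
have eM : (ell * (M %/ ell).+1 = M.+1)%N.
  by rewrite -add1n -[1%N]/(true : nat) -dvdM -divnS // mulnC divnK.
rewrite add1n overpart_gf_upto_dvd // mulrCA [RHS]mulrCA; congr (_ * _).
rewrite -[X in 1 + X](_ : dil ell (fpsX ^+ (M %/ ell).+1) = _); last by rewrite dil_Xn // eM.
rewrite -[X in 1 - X](_ : dil ell (fpsX ^+ (M %/ ell).+1) = _); last by rewrite dil_Xn // eM.
rewrite -(rmorph1 (dil ell)) -rmorphD -rmorphB -!rmorphM /=.
by rewrite overpart_gf_upto0S.
Qed.

Lemma eqmodX_dil m n a b : eqmodX (n %/ m) a b -> eqmodX n (dil m a) (dil m b).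
Proof. by move=> e i le_in /=; rewrite e // leq_div2r. Qed.

(** An overpartition splits into its parts divisible by [ell] and the others. As no
    integer is a positive multiple of [0], the series for [0] has no restriction. *)
Lemma overpart_gf_dil ell : (0 < ell)%N ->
  overpart_gf 0 = overpart_gf ell * dil ell (overpart_gf 0).
Proof.
move=> ell0; apply: fpsP => n; rewrite -(@overpart_gf_uptoE _ n _ (leqnn n)).
rewrite (@overpart_gf_upto_dil ell) //.
apply: (eqmodX_mul _ _ (leqnn n)); first exact: overpart_gf_uptoE.
exact/eqmodX_dil/overpart_gf_uptoE.
Qed.

(** [1 / (1 + q ^ k)], written through [1 / (1 - q ^ (2 k))]. *)
Definition inv1D k : fps := (1 - fpsX ^+ k) * geom k.*2.

Lemma inv1DP k : (0 < k)%N -> (1 + fpsX ^+ k) * inv1D k = 1.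
Proof.
move=> k0; rewrite -[RHS](@geomP k.*2) ?double_gt0 // -addnn exprD /inv1D -addnn; ring.
Qed.

Lemma prod_overpart_gf_upto M :
  \prod_(0 <= i < M) ((1 - fpsX ^+ i.+1) * inv1D i.+1) * overpart_gf_upto 0 M = 1.
Proof.
elim: M => [|M IHM]; first by rewrite big_geq // mul1r overpart_gf_upto0.
rewrite big_nat_recr //= -mulrA mulrAC overpart_gf_upto0S mulrAC inv1DP // mul1r.
exact: IHM.
Qed.

Lemma fcoef_signM k a n : ((-1) ^+ k * a : fps) n = (-1) ^+ k * a n.
Proof.
rewrite -signr_odd -[in RHS]signr_odd; case: odd; last by rewrite !mul1r.
by rewrite !expr1 !mulN1r.
Qed.

Lemma sgn_phi_prod n :
  eqmodX n (sgn phi) (\prod_(0 <= i < n) ((1 - fpsX ^+ i.+1) * inv1D i.+1)).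
Proof.
move=> i le_in.
have fin := gauss_finite inv1DP n.
have -> : sgn phi i = (1 + 2%:R * \sum_(k < n) (-1) ^+ k.+1 * fpsX ^+ (k.+1 ^ 2)) i.
  rewrite -[LHS]/((-1) ^+ i * phi i) (coef_phi le_in) fcoefD fcoef_natM fcoef_sum fcoef1.
  rewrite mulrDr mulrCA mulr_sumr; congr (_ + _ * _).
    by case: eqP => [->|]; rewrite ?mulr1 ?mulr0.
  apply: eq_bigr => k _; rewrite fcoef_signM fcoefXn.
  case: eqP => [->|]; last by rewrite !mulr0.
  by rewrite -signr_odd -[in RHS]signr_odd oddX.
rewrite -fin big_ord_recl fcoefD fcoef_sum [X in _ + X]big1 => [|k _].
  by rewrite addr0 mul0n expr0 !mul1r.
rewrite [_ * fpsX ^+ _]mulrC -mulrA; apply: (@eqmodXn _ i _ _ i (leqnn i)).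
by rewrite lift0 mulSn addSn ltnS (leq_trans le_in) ?leq_addr.
Qed.

(** Gauss: [sgn phi] is the infinite product of the [(1 - q ^ i) / (1 + q ^ i)], the
    inverse of the generating function of overpartitions. *)
Lemma sgn_phi_overpart_gf : sgn phi * overpart_gf 0 = 1.
Proof.
apply: fpsP => n; rewrite -[in RHS](prod_overpart_gf_upto n).
apply: (eqmodX_mul _ _ (leqnn n)); first exact: sgn_phi_prod.
by move=> i le_in; rewrite overpart_gf_uptoE.
Qed.

End GeneratingFunctions.

(** * The logarithmic derivative of the overpartition product *)

Section LogDerivative.
Local Open Scope ring_scope.
Implicit Types (M n k : nat).

(** The logarithmic derivative of [(1 + q ^ k) / (1 - q ^ k)]. *)
Definition dlog k : fps := 2%:R * (k%:R * (fpsX ^+ k * geom k.*2)).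

Lemma dlogP k : (0 < k)%N ->
  (1 - fpsX ^+ k) * (1 + fpsX ^+ k) * dlog k = 2%:R * (k%:R * fpsX ^+ k).
Proof.
move=> k0; have g : (1 - fpsX ^+ k) * (1 + fpsX ^+ k) * geom k.*2 = 1.
  by rewrite -[RHS](@geomP k.*2) ?double_gt0 // -addnn exprD; ring.
transitivity (2%:R * (k%:R * (fpsX ^+ k * ((1 - fpsX ^+ k) * (1 + fpsX ^+ k) * geom k.*2)))).
  by rewrite /dlog; ring.
by rewrite g mulr1.
Qed.

Lemma qderiv_overpart_gf_upto M :
  qderiv (overpart_gf_upto 0 M) = (\sum_(k < M) dlog k.+1) * overpart_gf_upto 0 M.
Proof.
elim: M => [|M IHM]; first by rewrite overpart_gf_upto0 qderiv1 big_ord0 mul0r.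
rewrite big_ord_recr /=; set L := bigop _ _ _ in IHM *.
have rec := overpart_gf_upto0S M; set Q := overpart_gf_upto 0 M.+1 in rec *.
set Q' := overpart_gf_upto 0 M in rec IHM *; set X := fpsX ^+ M.+1 in rec *.
have dX : qderiv X = M.+1%:R * X by apply: qderivXn.
have dX1 : qderiv (1 - X) = - (M.+1%:R * X).
  by rewrite qderivB qderiv1 dX sub0r.
have dX2 : qderiv (1 + X) = M.+1%:R * X by rewrite qderivD qderiv1 add0r.
have := congr1 qderiv rec; rewrite !qderivM dX1 dX2 IHM => drec.
have dl := @dlogP M.+1 isT; rewrite -/X in dl.
(* multiply by 1 + X, then cancel 1 - X and 1 + X one after the other *)
have key : (1 - X) * ((1 + X) * qderiv Q) = (1 - X) * ((1 + X) * ((L + dlog M.+1) * Q)).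
  transitivity ((1 + X) * (M.+1%:R * X * Q + (- (M.+1%:R * X) * Q + (1 - X) * qderiv Q))).
    by ring.
  rewrite drec.
  transitivity ((M.+1%:R * X) * (1 + X) * Q + (M.+1%:R * X) * ((1 + X) * Q')
    + (1 + X) * L * ((1 + X) * Q')).
    by ring.
  rewrite -rec.
  transitivity (((1 - X) * (1 + X) * L + 2%:R * (M.+1%:R * X)) * Q); first by ring.
  by rewrite -dl; ring.
have := geom_regular (isT : (0 < M.+1)%N) key.
move/(congr1 ( *%R (inv1D M.+1))); rewrite !mulrA ![_ * (1 + X)]mulrC inv1DP //.
by rewrite !mul1r.
Qed.

Definition dlogs := Fps (fun n => \sum_(k < n) dlog k.+1 n).

Lemma coef_dlog k n : dlog k n =
  2%:R * (k%:R * (if (k <= n)%N then (k.*2 %| n - k)%N%:R else 0)).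
Proof. by rewrite /dlog !fcoef_natM fcoefXnM. Qed.

Lemma qderiv_overpart_gf : qderiv (overpart_gf 0) = dlogs * overpart_gf 0.
Proof.
apply: fpsP => n; transitivity (qderiv (overpart_gf_upto 0 n) n).
  by rewrite -[LHS]/(n%:R * overpart_gf 0 n) -(@overpart_gf_uptoE _ n _ (leqnn n)).
rewrite qderiv_overpart_gf_upto; apply: (eqmodX_mul _ _ (leqnn n)); last exact: overpart_gf_uptoE.
move=> i le_in; pose G k := dlog k.+1 i.
rewrite fcoef_sum -[dlogs i]/(\sum_(k < i) G k) -(big_mkord xpredT G).
have tail0 : \sum_(i <= k < n) G k = 0.
  apply: big1_seq => k /andP[_]; rewrite mem_index_iota => /andP[le_ik _].
  by rewrite /G coef_dlog ltnNge le_ik /= !mulr0.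
by rewrite (@big_cat_nat _ _ _ i) //= tail0 addr0 big_mkord.
Qed.

Definition sigma n : nat := \sum_(d <- divisors n) d.
Definition odd_sigma := Fps (fun n => if odd n then (sigma n)%:R else 0).

(** For odd [n], the quotient of [n] by a divisor is odd; this is what turns the
    coefficients of [dlogs] into a sum over all divisors. *)
Lemma dvdn_double_sub d n :
  odd n -> (d <= n)%N -> (d.*2 %| n - d)%N = (d %| n)%N.
Proof.
move=> odd_n le_dn; apply/idP/idP => [dv|/dvdnP[m nE]].
  by rewrite -(subnK le_dn) dvdn_addl // (dvdn_trans _ dv) // -muln2 dvdn_mulr.
have odd_m : odd m by move: odd_n; rewrite nE oddM => /andP[].
have := odd_double_half m; rewrite odd_m => mE.
by apply/dvdnP; exists m./2; rewrite nE -{1}mE; lia.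
Qed.

Lemma dlogs_odd n : odd n -> dlogs n = 2%:R * (sigma n)%:R.
Proof.
move=> odd_n; have n0 : (0 < n)%N by case: n odd_n.
have -> : sigma n = (\sum_(d <- iota 1 n | d %| n) d)%N.
  rewrite -big_filter; apply/perm_big/uniq_perm;
    rewrite ?divisors_uniq ?filter_uniq ?iota_uniq //.
  move=> d; rewrite mem_filter mem_iota -dvdn_divisors //; case: (boolP (d %| n)%N) => //= dn.
  by rewrite add1n ltnS (dvdn_leq n0 dn) (dvdn_gt0 n0 dn).
rewrite -[LHS]/(\sum_(k < n) dlog k.+1 n) natr_sum mulr_sumr [RHS]big_mkcond.
rewrite (iotaDl 1 0 n) big_map -[iota 0 n](_ : index_iota 0 n = _); last first.
  by rewrite /index_iota subn0.
rewrite [RHS]big_mkord; apply: eq_bigr => k _.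
rewrite coef_dlog add1n ltn_ord.
rewrite dvdn_double_sub //.
by case: ifP => _; rewrite ?mulr1 ?mulr0.
Qed.

(** Only odd exponents survive, where [dlogs] is twice the sum of divisors. *)
Lemma dlogs_sgn : dlogs - sgn dlogs = 4%:R * odd_sigma.
Proof.
apply: fpsP => n; rewrite fcoefB fcoef_natM.
rewrite -[sgn dlogs n]/((-1) ^+ n * dlogs n).
rewrite -[odd_sigma n]/(if odd n then (sigma n)%:R else 0).
rewrite -signr_odd; case: ifP => odd_n; last by rewrite mul1r subrr mulr0.
by rewrite dlogs_odd //; ring.
Qed.

End LogDerivative.

(** * Chebyshev polynomials *)

Section Chebyshev.
Local Open Scope ring_scope.

(** The Chebyshev polynomial of the first kind [T_n], evaluated at [t]. *)
Fixpoint cheb (R : comNzRingType) (t : R) n : R :=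
  match n with
  | 0 => 1
  | 1 => t
  | (n'.+1 as m).+1 => 2%:R * t * cheb t m - cheb t n'
  end.

Variables R R' : comNzRingType.

Lemma cheb_ind (P : nat -> Prop) :
  P 0%N -> P 1%N -> (forall n, P n -> P n.+1 -> P n.+2) -> forall n, P n.
Proof.
move=> P0 P1 PSS n; suff [] : P n /\ P n.+1 by [].
by elim: n => [|n [IH1 IH2]]; split=> //; apply: PSS.
Qed.

Lemma chebSS (t : R) n : cheb t n.+2 = 2%:R * t * cheb t n.+1 - cheb t n.
Proof. by []. Qed.

Lemma rmorph_cheb (f : {rmorphism R -> R'}) t n : f (cheb t n) = cheb (f t) n.
Proof.
elim/cheb_ind: n => [||n IH1 IH2]; rewrite ?rmorph1 //.
by rewrite !chebSS rmorphB !rmorphM rmorph_nat IH1 IH2.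
Qed.

Lemma cheb_pow (u v t : R) n :
  u * v = 1 -> u + v = 2%:R * t -> u ^+ n + v ^+ n = 2%:R * cheb t n.
Proof.
move=> uv sum_uv; elim/cheb_ind: n => [||n IH1 IH2]; first by rewrite !expr0 mulr1.
  by rewrite !expr1.
rewrite chebSS.
transitivity ((u + v) * (u ^+ n.+1 + v ^+ n.+1) - u * v * (u ^+ n + v ^+ n)).
  by rewrite !exprS; ring.
by rewrite uv sum_uv IH1 IH2; ring.
Qed.

(** [T_(2 n) = T_n o T_2]: the source of all the powers of two below. *)
Lemma cheb_double (t : R) n : cheb t n.*2 = cheb (2%:R * t ^+ 2 - 1) n.
Proof.
elim/cheb_ind: n => [||n IH1 IH2] //; first by rewrite chebSS /=; ring.
rewrite [RHS]chebSS -IH1 -IH2 !doubleS !chebSS; ring.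
Qed.

End Chebyshev.

(** * Subrings generated by one element *)

Section Subrings.
Local Open Scope ring_scope.
Variable R : comNzRingType.
Implicit Types (a b w y : R) (S : R -> Prop).

Definition is_subring S :=
  [/\ S 1, forall a b, S a -> S b -> S (a - b) & forall a b, S a -> S b -> S (a * b)].

Section SubringTheory.
Variables (S : R -> Prop) (subS : is_subring S).

Lemma subring0 : S 0.
Proof. by case: subS => S1 SB _; rewrite -(subrr 1); apply: SB. Qed.

Lemma subringD a b : S a -> S b -> S (a + b).
Proof.
case: subS => _ SB _ Sa Sb; rewrite -[b]opprK; apply: (SB) => //.
by rewrite -sub0r; apply: SB => //; apply: subring0.
Qed.

Lemma subring_int (k : int) : S k%:~R.
Proof.
have [S1 SB _] := subS; have Sn n : S n%:R.
  by elim: n => [|n IHn]; rewrite ?mulrS; [apply: subring0 | apply: subringD].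
case: k => n; first exact: Sn.
by rewrite NegzE mulrNz -sub0r; apply: (SB) (Sn n.+1); apply: subring0.
Qed.

Lemma subringX a n : S a -> S (a ^+ n).
Proof.
case: subS => S1 _ SM Sa; elim: n => [|n IHn]; rewrite ?expr0 // exprS.
exact: SM.
Qed.

Lemma subring_sum I (r : seq I) (F : I -> R) :
  (forall i, S (F i)) -> S (\sum_(i <- r) F i).
Proof.
by move=> SF; elim/big_ind: _ => //; [apply: subring0 | apply: subringD].
Qed.

Lemma subring_cheb t n : S t -> S (cheb t n).
Proof.
have [S1 SB SM] := subS => St; elim/cheb_ind: n => // n IH1 IH2.
rewrite chebSS; apply: SB => //; apply: (SM) => //; apply: SM => //.
exact: (subring_int 2).
Qed.

End SubringTheory.

(** [Z[w]], as the values at [w] of polynomials: an additive map is then controlled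
    by its values on the powers of [w]. *)
Definition adj w a := exists p : {poly int}, a = (map_poly intr p).[w].

Lemma adj_subring w : is_subring (adj w).
Proof.
split=> [|_ _ [p ->] [q ->]|_ _ [p ->] [q ->]].
- by exists 1; rewrite rmorph1 hornerC.
- by exists (p - q); rewrite rmorphB hornerD hornerN.
- by exists (p * q); rewrite rmorphM hornerM.
Qed.

Lemma adj_gen w : adj w w.
Proof. by exists 'X; rewrite map_polyX hornerX. Qed.

Lemma adj_sum w a : adj w a ->
  exists n (k : nat -> int), a = \sum_(i < n) w ^+ i *~ k i.
Proof.
case=> p ->; exists (size p), (fun i => p`_i).
rewrite (horner_coef_wide _ (size_poly _ _)); apply: eq_bigr => i _.
by rewrite coef_map /= mulrzl.
Qed.

Lemma adj_additive S w (f : {additive R -> R}) a :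
  is_subring S -> (forall k, S (f (w ^+ k))) -> adj w a -> S (f a).
Proof.
move=> subS Sf /adj_sum[n [k ->]]; rewrite raddf_sum /=.
apply: subring_sum => // i; rewrite raddfMz -mulrzl.
by case: (subS) => _ _; apply=> //; apply: subring_int.
Qed.

Lemma adj_sub S w a : is_subring S -> S w -> adj w a -> S a.
Proof.
move=> subS Sw; apply: (@adj_additive S w idfun) => // k.
exact: subringX.
Qed.

(** [Z + m y Z[y]]. That it is a ring lets a single congruence for the argument
    of a Chebyshev polynomial pass to its value. *)
Definition adj_mod (m : int) y a :=
  exists k : int, exists2 s, adj y s & a = k%:~R + m%:~R * y * s.

Lemma adj_mod_subring m y : is_subring (adj_mod m y).
Proof.
have sub_y := adj_subring y; have [_ yB yM] := sub_y.
split=> [|_ _ [k [s ys ->]] [l [t yt ->]]|_ _ [k [s ys ->]] [l [t yt ->]]].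
- by exists 1, 0; [apply: subring0 | rewrite mulr0 addr0].
- exists (k - l), (s - t); first exact: yB.
  by rewrite intrB; ring.
exists (k * l), (k%:~R * t + l%:~R * s + m%:~R * y * s * t).
  apply: subringD => //; first apply: subringD => //; first by apply: yM => //; apply: subring_int.
    by apply: yM => //; apply: subring_int.
  apply: (yM) => //; apply: (yM) => //; apply: (yM); [exact: subring_int | exact: adj_gen].
by rewrite intrM; ring.
Qed.

Lemma adj_mul w m s : adj (m * w) s -> exists k : int, exists u, s = k%:~R + m * u.
Proof.
apply: (@adj_sub (fun s => exists k : int, exists u, s = k%:~R + m * u)).
  split=> [|_ _ [k [u ->]] [l [v ->]]|_ _ [k [u ->]] [l [v ->]]].
  - by exists 1, 0; rewrite mulr0 addr0.
  - by exists (k - l), (u - v); rewrite intrB; ring.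
  by exists (k * l), (k%:~R * v + l%:~R * u + m * u * v); rewrite intrM; ring.
by exists 0, w; rewrite add0r.
Qed.

End Subrings.

(** * Even parts of the powers of a qderiv quotient *)

Section Modular.
Local Open Scope ring_scope.
Implicit Types (a b n k : nat).

(** [phi(q) / phi(-q)]. *)
Definition theta_quot : fps := phi * overpart_gf 0.

Lemma phi_sgn_overpart_gf : phi * sgn (overpart_gf 0) = 1.
Proof. by rewrite -[phi]sgnK -rmorphM sgn_phi_overpart_gf rmorph1. Qed.

Lemma theta_quot_sgn : theta_quot * sgn theta_quot = 1.
Proof.
rewrite /theta_quot rmorphM /= mulrACA [overpart_gf 0 * _]mulrC mulrACA.
by rewrite phi_sgn_overpart_gf sgn_phi_overpart_gf mulr1.
Qed.

(** The inverse form of [phi(q) phi(-q) = phi(-q^2)^2]. *)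
Lemma dil2_overpart_gf : dil 2 (overpart_gf 0) ^+ 2 = overpart_gf 0 * sgn (overpart_gf 0).
Proof.
have W : dil 2 (sgn phi) * dil 2 (overpart_gf 0) = 1.
  by rewrite -rmorphM sgn_phi_overpart_gf rmorph1.
set A := dil 2 (overpart_gf 0) in W *; set Q := overpart_gf 0; set Q' := sgn Q.
transitivity ((phi * Q') * (sgn phi * Q) * A ^+ 2).
  by rewrite phi_sgn_overpart_gf sgn_phi_overpart_gf !mul1r.
transitivity (phi * sgn phi * A ^+ 2 * (Q * Q')); first by ring.
rewrite sgn_phi_mul.
transitivity ((dil 2 (sgn phi) * A) ^+ 2 * (Q * Q')); first by ring.
by rewrite W expr1n mul1r.
Qed.

(** A modular equation of degree two. With [theta_quot_sgn] it makes [theta_quot] and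
    its twist the roots of a quadratic polynomial over the series in [q ^ 2]. *)
Lemma theta_quot_add : theta_quot + sgn theta_quot = 2%:R * dil 2 (theta_quot ^+ 2).
Proof.
rewrite /theta_quot [in RHS]exprMn [in RHS]rmorphM /= !rmorphXn /=.
rewrite dil2_overpart_gf mulrA -phi2_add rmorphM /=.
set Q := overpart_gf 0; set Q' := sgn Q.
transitivity (phi * Q * (phi * Q') + sgn phi * Q' * (sgn phi * Q)).
  by rewrite phi_sgn_overpart_gf sgn_phi_overpart_gf !mulr1.
by ring.
Qed.

(** The sums of equal powers of the roots [u] and [1 / u] of a quadratic polynomial are
    Chebyshev polynomials in their half sum. *)
Lemma evens_theta_quotX a : evens (theta_quot ^+ a) = cheb (theta_quot ^+ 2) a.
Proof.
apply: evensE; rewrite [dil 2 _]rmorph_cheb rmorphXn.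
exact: cheb_pow theta_quot_sgn theta_quot_add.
Qed.

(** The generating function of the pairs of [2 ^ k]-regular overpartitions, by
    [coef_Bbar]. *)
Definition Bgf k : fps := overpart_gf (2 ^ k) ^+ 2.

Lemma overpart_gfE ell : (0 < ell)%N -> overpart_gf ell = overpart_gf 0 * dil ell (sgn phi).
Proof.
move=> ell0; rewrite (overpart_gf_dil ell0) -mulrA -rmorphM [overpart_gf 0 * _]mulrC.
by rewrite sgn_phi_overpart_gf rmorph1 mulr1.
Qed.

Lemma Bgf0 : Bgf 0 = 1.
Proof.
by rewrite /Bgf expn0 overpart_gfE // dil1 mulrC sgn_phi_overpart_gf expr1n.
Qed.

(** Because [1 / phi(-q)^2 = theta_quot / phi(-q^2)^2], while the numerator
    [phi(-q^L)^2] with [L = 2^(k+1)] is already a series in [q ^ 2]. *)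
Lemma BgfS k : Bgf k.+1 = dil 2 (Bgf k) * theta_quot.
Proof.
have pos i : (0 < 2 ^ i)%N by rewrite expn_gt0.
rewrite /Bgf (overpart_gfE (pos k.+1)) (overpart_gfE (pos k)) expnS -dil_dil // rmorphXn rmorphM /=.
rewrite !exprMn dil2_overpart_gf /theta_quot.
set W := dil 2 _; set Q := overpart_gf 0; set Q' := sgn Q.
transitivity (Q ^+ 2 * (phi * Q') * W ^+ 2); first by rewrite phi_sgn_overpart_gf mulr1.
by ring.
Qed.

Definition quot_y : fps := theta_quot ^+ 4 - 1.

(** By [BgfS] and [evens_dilM], each extraction of even coefficients strips one
    factor off the generating function and replaces [f] by the even part of
    [f * theta_quot]. *)
Lemma evens_Bgf k f : adj theta_quot f ->
  adj (theta_quot ^+ 2) (iter k.+1 evens (Bgf k.+1 * f)).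
Proof.
have [_ _ M1] := adj_subring theta_quot.
have ev g : adj theta_quot g -> adj (theta_quot ^+ 2) (evens g).
  move=> xg; apply: (adj_additive (f := evens)) xg => [|i]; first exact: adj_subring.
  by rewrite /= evens_theta_quotX; apply: subring_cheb; [apply: adj_subring | apply: adj_gen].
elim: k f => [|k IHk] f xf.
  rewrite /= BgfS -mulrA evens_dilM Bgf0 mul1r; apply: ev.
  by apply: M1 => //; apply: adj_gen.
rewrite iterSr BgfS -mulrA evens_dilM; apply: IHk.
have x2 : adj theta_quot (theta_quot ^+ 2).
  by apply: subringX; [apply: adj_subring | apply: adj_gen].
apply: (adj_sub (adj_subring theta_quot) x2); apply: ev.
by apply: M1 => //; apply: adj_gen.
Qed.

Lemma evens_theta_quot2X n : evens ((theta_quot ^+ 2) ^+ n) = cheb (1 + 2%:R * quot_y) n.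
Proof.
rewrite -exprM mul2n evens_theta_quotX cheb_double; congr (cheb _ n); rewrite /quot_y; ring.
Qed.

(** Fractional powers of [1 + quot_y] disappear: [T_2] sends the square of [theta_quot]
    to [1 + 2 quot_y]. *)
Lemma evens_adj_quot2 f : adj (theta_quot ^+ 2) f -> adj_mod 2 quot_y (evens f).
Proof.
apply: (adj_additive (f := evens)) => [|n]; first exact: adj_mod_subring.
rewrite /= evens_theta_quot2X; apply: subring_cheb; first exact: adj_mod_subring.
by exists 1, 1; [case: (adj_subring quot_y) | rewrite mulr1].
Qed.

(** The gain of [8]: [T_4] sends the square of [theta_quot] to
    [1 + 8 quot_y (1 + quot_y)]. *)
Lemma evens_adj_quot_y f : adj quot_y f -> adj_mod 8 quot_y (evens f).
Proof.
have x4 : adj (theta_quot ^+ 4) quot_y.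
  by have [? xB _] := adj_subring (theta_quot ^+ 4); apply: xB => //; apply: adj_gen.
move/(adj_sub (adj_subring _) x4).
apply: (adj_additive (f := evens)) => [|n]; first exact: adj_mod_subring.
rewrite /= (_ : (theta_quot ^+ 4) ^+ n = (theta_quot ^+ 2) ^+ n.*2); last first.
  by rewrite -!exprM -mul2n mulnA.
rewrite evens_theta_quot2X cheb_double; apply: subring_cheb; first exact: adj_mod_subring.
exists 1, (1 + quot_y); last by ring.
by apply: subringD; [apply: adj_subring | case: (adj_subring quot_y) | apply: adj_gen].
Qed.

Lemma evens1 : evens 1 = 1.
Proof. by apply: fpsP => -[|n]. Qed.

Lemma evens_adj_mod (m : int) f : adj_mod m quot_y f -> adj_mod (8 * m) quot_y (evens f).
Proof.
case=> k [s ys ->]; have [_ _ yM] := adj_subring quot_y.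
have [l [t yt e]] := evens_adj_quot_y (yM _ _ (adj_gen quot_y) ys).
exists (k + m * l), t => //.
rewrite -mulrA mulrzl raddfD /= !raddfMz /= evens1 e.
by rewrite -mulrzl intrD !intrM; ring.
Qed.

Lemma iter_evens k f n : iter k evens f n = f (2 ^ k * n)%N.
Proof.
elim: k n => [|k IHk] n /=; first by rewrite mul1n.
by rewrite IHk -mul2n mulnA expnSr.
Qed.

Lemma evens_Bgf_mod k b :
  adj_mod (8 ^+ b * 2) quot_y (iter (k.+1 + b.+1) evens (Bgf k.+1)).
Proof.
elim: b => [|b IHb]; last by rewrite addnS iterS exprS -mulrA; apply: evens_adj_mod.
rewrite addn1 iterS expr0 mul1r -[Bgf _]mulr1; apply/evens_adj_quot2/evens_Bgf.
by case: (adj_subring theta_quot).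
Qed.

(** ** Divisibility of [quot_y] by sixteen *)

Definition odd_squares :=
  Fps (fun n => if odd n then \sum_(k < n) (n == k.+1 ^ 2)%N%:R else 0).

Lemma phi_odd : phi = sgn phi + 4%:R * odd_squares.
Proof.
apply: fpsP => n; rewrite fcoefD fcoef_natM -[sgn phi n]/((-1) ^+ n * phi n) -signr_odd.
rewrite -[odd_squares n]/(if odd n then \sum_(k < n) (n == k.+1 ^ 2)%N%:R else 0).
case: ifP => odd_n; last by rewrite mul1r mulr0 addr0.
rewrite (coef_phi (leqnn n)).
by case: eqP odd_n => [->//|_ _]; rewrite expr1 !add0r; ring.
Qed.

(** [theta_quot = 1 + 4 quot_z], because a nonzero square has two square roots. *)
Definition quot_z : fps := odd_squares * overpart_gf 0.
(** One sixteenth of [(1 + 4 quot_z) ^ 4 - 1], that is of [quot_y]. *)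
Definition quot_c : fps :=
  quot_z + 6%:R * quot_z ^+ 2 + 16%:R * quot_z ^+ 3 + 16%:R * quot_z ^+ 4.

Lemma theta_quot4E : theta_quot ^+ 4 = 1 + 16%:R * quot_c.
Proof.
have -> : theta_quot = 1 + 4%:R * quot_z.
  by rewrite /theta_quot phi_odd mulrDl sgn_phi_overpart_gf mulrA.
by rewrite /quot_c; ring.
Qed.

(** As a product, [theta_quot] has an explicit logarithmic derivative. *)
Lemma qderiv_theta_quot : qderiv theta_quot = 4%:R * odd_sigma * theta_quot.
Proof.
have dsgn : qderiv (sgn phi) = - dlogs * sgn phi.
  have := congr1 qderiv sgn_phi_overpart_gf; rewrite qderivM qderiv1 qderiv_overpart_gf => e.
  rewrite -[LHS]mulr1 -sgn_phi_overpart_gf.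
  transitivity (sgn phi * (qderiv (sgn phi) * overpart_gf 0 + sgn phi * (dlogs * overpart_gf 0))
    - dlogs * sgn phi * (sgn phi * overpart_gf 0)); first by ring.
  by rewrite e sgn_phi_overpart_gf; ring.
have dphi : qderiv phi = - sgn dlogs * phi.
  by rewrite -[in LHS](sgnK phi) qderiv_sgn dsgn rmorphM rmorphN /= sgnK.
by rewrite qderivM dphi qderiv_overpart_gf -dlogs_sgn /theta_quot; ring.
Qed.

(** Hence [n] times the coefficient of [q ^ n] in [quot_c] is, modulo [16], the sum
    of the divisors of [n] if [n] is odd. *)
Lemma qderiv_quot_c : qderiv quot_c = odd_sigma * (1 + 16%:R * quot_c).
Proof.
apply: (@fps_natI 16) => //; rewrite -qderiv_natM.
have -> : 16%:R * quot_c = theta_quot ^+ 4 - 1 by rewrite theta_quot4E; ring.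
rewrite qderivB qderiv1 subr0 [1 + _]addrC subrK.
have qderiv4 f : qderiv (f ^+ 4) = 4%:R * f ^+ 3 * qderiv f.
  by rewrite !exprS expr0 mulr1 !qderivM; ring.
by rewrite qderiv4 qderiv_theta_quot; ring.
Qed.

Lemma evens_quot_c : evens quot_c = 8%:R * quot_c + 128%:R * quot_c ^+ 2.
Proof.
apply: (@fps_natI 16) => //.
have ev f : evens (1 + 16%:R * f) = 1 + 16%:R * evens f.
  by rewrite !mulr_natl raddfD raddfMn /= evens1.
have -> : 16%:R * evens quot_c = evens (theta_quot ^+ 4) - 1.
  by rewrite theta_quot4E ev addrC addKr.
rewrite -[evens (theta_quot ^+ 4)]/(evens (theta_quot ^+ 2.*2)) evens_theta_quotX cheb_double.
have cheb2 t : cheb t 2 = 2%:R * t ^+ 2 - 1 :> fps by rewrite /=; ring.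
rewrite cheb2 -exprM theta_quot4E; ring.
Qed.

End Modular.

(** * Sums of divisors modulo sixteen *)

Section Arithmetic.
Implicit Types (a d e i j k m n p : nat).

Lemma sum_expnD p m n :
  \sum_(i < m + n) p ^ i = \sum_(i < m) p ^ i + p ^ m * \sum_(i < n) p ^ i.
Proof.
rewrite big_split_ord big_distrr /=; congr (_ + _).
by apply: eq_bigr => i _; rewrite expnD.
Qed.

Lemma dvdn_sum_expn p m k : \sum_(i < m) p ^ i %| \sum_(i < m * k) p ^ i.
Proof.
elim: k => [|k IHk]; first by rewrite muln0 big_ord0 dvdn0.
by rewrite mulnS sum_expnD dvdn_add // dvdn_mull.
Qed.

(** Each doubling of the number of terms contributes an even factor [1 + p ^ m]. *)
Lemma dvdn_sum_expn_pow2 p a i : odd p -> 2 ^ a %| p.+1 ->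
  2 ^ (a + i) %| \sum_(l < 2 ^ i.+1) p ^ l.
Proof.
move=> odd_p dvd_p; elim: i => [|i IHi].
  by rewrite addn0 !big_ord_recl big_ord0 /= addn0 expn0 expn1 add1n.
rewrite expnS mul2n -addnn sum_expnD -mulSn addnS expnS.
by rewrite dvdn_mul // dvdn2 oddS oddX odd_p orbT.
Qed.

Lemma sigma_prime_power p e m : prime p -> ~~ (p %| m) -> 0 < m ->
  sigma (p ^ e * m) = (\sum_(i < e.+1) p ^ i) * sigma m.
Proof.
move=> p_pr pm m0; have p0 := prime_gt0 p_pr.
have cop i d : d %| m -> coprime (p ^ i) d.
  by move=> dm; rewrite coprimeXl // prime_coprime //; apply: contra pm => /dvdn_trans->.
rewrite /sigma big_distrl /=.
rewrite -(big_mkord xpredT (fun i => p ^ i * \sum_(d <- divisors m) d)) /index_iota subn0.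
under [RHS]eq_bigr => i _ do rewrite big_distrr /=.
rewrite -(big_allpairs_dep (h := fun i d => p ^ i * d) (r2 := fun=> divisors m) (F := id)).
apply/perm_big/uniq_perm; first exact: divisors_uniq.
  apply: allpairs_uniq; rewrite ?iota_uniq ?divisors_uniq // => -[i d] [i' d'].
  move=> /allpairsP[[a b] [_ bm [-> ->]]] /allpairsP[[a' b'] [_ b'm [-> ->]]] ebe.
  rewrite -!dvdn_divisors //= in bm b'm ebe *.
  have := congr1 (logn p) ebe.
  have nd b0 : b0 %| m -> logn p b0 = 0.
    by move=> b0m; apply: logn_coprime; have := cop 1 _ b0m; rewrite expn1.
  rewrite !lognM ?expn_gt0 ?p0 ?(dvdn_gt0 m0) // !pfactorK // !nd // !addn0 => aa'.
  move: ebe; rewrite aa' => /eqP; rewrite eqn_pmul2l ?expn_gt0 ?p0 // => /eqP->.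
  by [].
move=> d; rewrite -dvdn_divisors ?muln_gt0 ?expn_gt0 ?p0 //.
apply/idP/allpairsP => [dv|[[i d'] [+ + ->]]]; last first.
  rewrite mem_iota add0n ltnS -dvdn_divisors // => /= le_ie d'm.
  by rewrite dvdn_mul // dvdn_exp2l.
have := dvdn_gcdr d (p ^ e) => /(dvdn_pfactor _ _ p_pr)[i le_ie gE].
exists (i, gcdn d m); rewrite mem_iota add0n ltnS le_ie -dvdn_divisors // dvdn_gcdr; split=> //=.
rewrite -gE; apply/eqP; rewrite eqn_dvd; apply/andP; split; last first.
  by rewrite Gauss_dvd ?dvdn_gcdl //= gE cop // dvdn_gcdr.
by rewrite muln_gcdr dvdn_gcd dvdn_mull //= muln_gcdl dvdn_gcd dvdn_mulr ?dv.
Qed.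

End Arithmetic.

(** * The coefficients of the generating functions *)

Section Coefficients.
Local Open Scope ring_scope.

Lemma dvd16_quot_c_odd n : odd n -> (16 %| sigma n)%N -> (16 %| quot_c n)%Z.
Proof.
move=> odd_n sig_n.
have : qderiv quot_c n = (odd_sigma * (1 + 16%:R * quot_c)) n by rewrite qderiv_quot_c.
rewrite mulrDr mulr1 mulrCA fcoefD fcoef_natM.
rewrite -[qderiv quot_c n]/(n%:R * quot_c n) -[odd_sigma n]/(if odd n then (sigma n)%:R else 0).
rewrite odd_n => e.
have cop : coprimez 16 n%:Z by rewrite coprimezE; apply: (@coprimeXl 4 2); rewrite coprime2n.
rewrite -(Gauss_dvdzr _ cop).
have -> : n%:Z * quot_c n = (sigma n)%:Z + 16 * (odd_sigma * quot_c) n.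
  by rewrite -natz e -natz.
by apply: rpredD; [apply: sig_n | apply: dvdz_mulr].
Qed.

(** Odd arguments reduce to the sum of divisors, which has the factor
    [1 + p + ... + p ^ e]. For even arguments, [evens_quot_c] gives the coefficient of
    [quot_c] as eight times that at half the argument, modulo [128]. *)
Lemma dvd16_quot_c_prime_power p e m : prime p -> odd p ->
  (16 %| \sum_(i < e.+1) p ^ i)%N -> (0 < m)%N -> ~~ (p %| m)%N ->
  (16 %| quot_c (p ^ e * m)%N)%Z.
Proof.
move=> p_pr odd_p sum16; elim/ltn_ind: m => m IHm m0 pm.
have [odd_m|even_m] := boolP (odd m).
  apply: dvd16_quot_c_odd; first by rewrite oddM oddX odd_p orbT.
  by rewrite sigma_prime_power // dvdn_mulr.
have mE : m = (m./2).*2 by rewrite -[LHS]odd_double_half (negPf even_m).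
have -> : (p ^ e * m = (p ^ e * m./2).*2)%N by rewrite [in LHS]mE -!mul2n mulnCA.
rewrite -[quot_c _]/(evens quot_c (p ^ e * m./2)%N) evens_quot_c fcoefD !fcoef_natM.
have c16 : (16 %| quot_c (p ^ e * m./2)%N)%Z.
  apply: IHm; [lia | lia |].
  by apply: contra pm => dv; rewrite mE -mul2n dvdn_mull.
by apply: rpredD; [apply: dvdz_mull | apply: dvdz_mulr].
Qed.

Lemma fcoef_intM (k : int) (f : fps) n : (k%:~R * f) n = k * f n.
Proof.
case: k => k; first by rewrite -[_%:~R]/(k%:R) fcoef_natM natz.
by rewrite NegzE mulrNz !mulNr fcoefN -[_%:~R]/(k.+1%:R) fcoef_natM natz.
Qed.

Lemma fcoef_int (k : int) n : (0 < n)%N -> (k%:~R : fps) n = 0.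
Proof.
move=> n0; rewrite -[_%:~R]mulr1 fcoef_intM fcoef1.
by case: n n0 => // n _; rewrite mulr0.
Qed.

(** Since [quot_y = 16 quot_c], the terms of degree at least two in [quot_y] are multiples of
    [256], so that only the coefficient of [quot_c] matters. *)
Lemma adj_mod_dvd (m : int) f n : (0 < n)%N -> (16 %| quot_c n)%Z ->
  adj_mod m quot_y f -> (m * 256 %| f n)%Z.
Proof.
move=> n0 c16 [k [s]]; have -> : quot_y = 16%:R * quot_c by rewrite /quot_y theta_quot4E; ring.
case/adj_mul=> l [u ->] ->; rewrite fcoefD fcoef_int // add0r.
have -> : m%:~R * (16%:R * quot_c) * (l%:~R + 16%:R * u) =
   (m * 16)%:~R * (l%:~R * quot_c + 16%:R * (quot_c * u)) by rewrite intrM; ring.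
rewrite fcoef_intM fcoefD fcoef_intM fcoef_natM.
have -> : m * 256 = m * 16 * 16 by rewrite -mulrA.
rewrite dvdz_mul //.
by apply: rpredD; [apply: dvdz_mull | apply: dvdz_mulr].
Qed.

End Coefficients.

Theorem corollary1p4 (n j p : nat) :
  1 <= j < 5 ->
  prime p ->
  ~~ (p %| n.+1) ->
  (p%:Z = -1 %[mod (2 ^ (5 - j))%N%:Z])%Z ->
  forall alpha k beta : nat, 1 <= alpha -> 1 <= k ->
    Bbar (2 ^ alpha)
      (2 ^ (alpha + beta + 1) * p ^ (2 ^ j * k - 1) * n.+1)
    = 0 %[mod 2 ^ (3 * beta + 9)].
Proof.
move=> /andP[j1 j5] p_pr pn p_mod alpha k beta alpha1 k1.
have dvd_p : 2 ^ (5 - j) %| p.+1.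
  move/eqP: p_mod; rewrite eqz_mod_dvd opprK.
  by rewrite /dvdz /= => dv; have -> : p.+1 = `|(p%:Z + 1)%R|%N by lia.
have odd_p : odd p.
  have : 2 %| p.+1 by apply: dvdn_trans dvd_p; rewrite -{1}(expn1 2) dvdn_exp2l; lia.
  by rewrite dvdn2 oddS negbK.
pose e := 2 ^ j * k - 1.
have eS : e.+1 = 2 ^ j * k by rewrite /e subn1 prednK // muln_gt0 expn_gt0.
have sum16 : 16 %| \sum_(i < e.+1) p ^ i.
  rewrite eS; apply: dvdn_trans (dvdn_sum_expn _ _ _).
  have := dvdn_sum_expn_pow2 j.-1 odd_p dvd_p; rewrite prednK //.
  by have -> : 5 - j + j.-1 = 4 by lia.
set N := p ^ e * n.+1.
have N0 : 0 < N by rewrite muln_gt0 expn_gt0 prime_gt0.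
have c16 := dvd16_quot_c_prime_power p_pr odd_p sum16 (ltn0Sn n) pn.
have := adj_mod_dvd N0 c16 (evens_Bgf_mod alpha.-1 beta).
rewrite iter_evens -coef_Bbar prednK // natz.
have -> : (8 ^+ beta * 2 * 256)%R = Posz (2 ^ (3 * beta + 9)).
  by rewrite expnD expnM PoszM -mulrA; congr (_ * _)%R; rewrite -natz natrX.
rewrite -[beta.+1]addn1 addnA mulnA => dv.
by rewrite mod0n; apply/eqP; exact: dv.
Qed.
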